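(* Let $N\ge 2$ and $n\ge 1$ be integers. (i) For any even Dirichlet character $\chi$ modulo $N$, $$L_{\mathbb{Z}/N\mathbb{Z}}(n,\chi)=2\sum_{i=1}^{n}c_{n,i}\frac{N^{2i}}{\pi^{2i}}L(2i,\chi),$$ and in particular $$\zeta_{\mathbb{Z}/N\mathbb{Z}}(n)=2\sum_{i=1}^{n}c_{n,i}\frac{N^{2i}-1}{\pi^{2i}}\zeta(2i).$$ (ii) For any odd Dirichlet character $\chi$ modulo $N$, $$\widetilde{L}_{\mathbb{Z}/N\mathbb{Z}}(n,\chi)=\frac{2}{n}\sum_{i=1}^{n}i\,c_{n,i}\frac{N^{2i+1}}{\pi^{2i+1}}L(2i+1,\chi).$$
   Context: A Dirichlet character modulo $N$ is a homomorphism $\chi:(\mathbb{Z}/N\mathbb{Z})^\times\to\mathbb{C}^\times$, extended to $\mathbb{Z}$ by $\chi(m)=0$ if $\gcd(m,N)>1$; it need not be primitive. It is even if $\chi(-1)=1$ and odd if $\chi(-1)=-1$. $L(s,\chi)=\sum_{k=1}^\infty\chi(k)k^{-s}$, and $\zeta$ is the Riemann zeta function. Set $$\zeta_{\mathbb{Z}/N\mathbb{Z}}(s)=\sum_{m=1}^{N-1}\frac{1}{\sin^{2s}(m\pi/N)},\quad L_{\mathbb{Z}/N\mathbb{Z}}(s,\chi)=\sum_{m=1}^{N-1}\frac{\chi(m)}{\sin^{2s}(m\pi/N)},\quad \widetilde{L}_{\mathbb{Z}/N\mathbb{Z}}(s,\chi)=\sum_{m=1}^{N-1}\frac{\chi(m)\cot(m\pi/N)}{\sin^{2s}(m\pi/N)}.$$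 $c_{n,i}$ is the coefficient of $x^{-2i}$ in the Laurent expansion of $(\sin x)^{-2n}$ at $x=0$. *)

(* Defs.v *)
From mathcomp Require Import all_boot all_order all_algebra all_fingroup.
From mathcomp Require Import complex.
From mathcomp Require Import all_classical all_reals all_analysis.
Set Implicit Arguments.
Unset Strict Implicit.
Unset Printing Implicit Defensive.
Import Order.TTheory GRing.Theory Num.Theory.
Import numFieldNormedType.Exports.
Local Open Scope classical_set_scope.
Local Open Scope ring_scope.
Local Open Scope complex_scope.

(* A homomorphism (Z/NZ)^* -> C^*.  Only meaningful for 1 < N, because 'Z_0
   and 'Z_1 both denote Z/2Z. *)
Record dirichlet_char (R : realType) (N : nat) := DirichletChar {
  dchar_val :> {unit 'Z_N} -> R[i];
  dchar_neq0 : forall u, dchar_val u != 0;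
  dcharM : forall u v, dchar_val (u * v)%g = dchar_val u * dchar_val v
}.

(* insub succeeds exactly when the class of m is invertible, that is when
   gcd(m, N) = 1. *)
Definition dchar_ext (R : realType) (N : nat) (chi : dirichlet_char R N)
    (m : int) : R[i] :=
  if insub (m%:~R : 'Z_N) is Some u then chi u else 0.

Lemma dchar_ext_eq0 (R : realType) (N : nat) (chi : dirichlet_char R N)
    (m : int) :
  (1 < N)%N -> (dchar_ext chi m == 0) = ~~ coprimez m N.
Proof.
move=> N1; have -> : coprimez m N = ((m%:~R : 'Z_N) \is a GRing.unit).
  have unitN (a : nat) : ((a%:R : 'Z_N) \is a GRing.unit) = coprime a N.
    by rewrite unitZpE // coprime_sym.
  rewrite /coprimez /gcdz /=; case: m => a.
    by rewrite -pmulrn unitN.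
  by rewrite NegzE mulrNz unitrN -pmulrn unitN.
rewrite /dchar_ext; case: insubP => [u -> _|/negbTE ->] /=.
  exact/negbTE/dchar_neq0.
by rewrite eqxx.
Qed.

Definition even_dchar (R : realType) (N : nat) (chi : dirichlet_char R N) :=
  dchar_ext chi (-1) = 1.

Definition odd_dchar (R : realType) (N : nat) (chi : dirichlet_char R N) :=
  dchar_ext chi (-1) = -1.

(* The series is summed in R[i]^o, the copy of R[i] that carries the normed
   topology.  It converges for every character only when 1 < s. *)
Definition dirichlet_L (R : realType) (N : nat) (chi : dirichlet_char R N)
    (s : nat) : R[i] :=
  lim (series (fun k : nat =>
    dchar_ext chi k.+1%:Z / k.+1%:R ^+ s : R[i]^o) @ \oo).

Definition riemann_zeta (R : realType) (s : nat) : R :=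
  lim (series (fun k : nat => (k.+1%:R ^+ s)^-1 : R) @ \oo).

Definition cot (R : realType) (x : R) : R := cos x / sin x.

Definition zeta_ZN (R : realType) (N s : nat) : R :=
  \sum_(1 <= m < N) (sin (m%:R * pi / N%:R) ^+ (2 * s))^-1.

Definition L_ZN (R : realType) (N : nat) (s : nat)
    (chi : dirichlet_char R N) : R[i] :=
  \sum_(1 <= m < N)
    dchar_ext chi m%:Z / (sin (m%:R * pi / N%:R) ^+ (2 * s))%:C.

Definition Ltilde_ZN (R : realType) (N : nat) (s : nat)
    (chi : dirichlet_char R N) : R[i] :=
  \sum_(1 <= m < N)
    dchar_ext chi m%:Z * (cot (m%:R * pi / N%:R))%:C
      / (sin (m%:R * pi / N%:R) ^+ (2 * s))%:C.

(* f x = sum_(k >= - M) a k x^k on a punctured neighbourhood of 0: the Laurent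
   expansion of f at 0, with finite principal part. *)
Definition laurent_expansion (R : realType) (f : R -> R) (a : int -> R) : Prop :=
  exists M : nat,
    (forall k : int, k < - M%:Z -> a k = 0) /\
    (exists2 r : R, 0 < r & forall x : R, 0 < `|x| < r ->
       series (fun j : nat => a (j%:Z - M%:Z) * x ^ (j%:Z - M%:Z)) @ \oo
         --> f x).

(* The expansion is unique when it exists. *)
Definition laurent_coef (R : realType) (f : R -> R) : int -> R :=
  xget (fun=> 0) [set a | laurent_expansion f a].

Definition c_coef (R : realType) (n i : nat) : R :=
  laurent_coef (fun x : R => (sin x ^+ (2 * n))^-1) (- (2 * i)%:Z).

(* Main.v *)
(* Differentiating cot x = lim_K sum_{-K <= k < K} (x + k pi)^-1 shows that
   sum_k (x + k pi)^-m is a polynomial q_m in cot x. The powers of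
   csc^2 = 1 + cot^2 are combinations of the q_{2i}, and since the principal
   part of q_m(cot x) at 0 is x^-m, the coefficients are the c_{n,i}:
     sin(x)^-2n = sum_i c_{n,i} sum_k (x + k pi)^-2i.
   One more derivative gives
     cot(x) sin(x)^-2n = (1/n) sum_i i c_{n,i} sum_k (x + k pi)^-(2i+1).
   At x = m pi / N, multiplying by chi(m) and summing over m regroups the inner
   sums into 2 (N/pi)^s L(s, chi), the negative k contributing as much as the
   positive ones by the parity of chi.

   No analytic differentiation of series is needed: q_m is defined by the
   polynomial recursion q_{m+1} = (1 + X^2) q_m' / m, and its partial fraction
   expansion is obtained by iterating the duplication formula
   q_m(cot (x/2)) + q_m(cot ((x+pi)/2)) = 2^m q_m(cot x). *)

Require Import Defs.
From mathcomp Require Import all_boot all_order all_algebra all_fingroup.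
From mathcomp Require Import complex.
From mathcomp Require Import all_classical all_reals all_analysis.
From mathcomp Require Import ring lra zify.
Import Order.TTheory GRing.Theory Num.Theory.
Import numFieldNormedType.Exports.
Local Open Scope ring_scope.
Local Open Scope complex_scope.
Local Open Scope classical_set_scope.

Set Implicit Arguments.
Unset Strict Implicit.
Unset Printing Implicit Defensive.

(** * Cotangent polynomials *)

(* The polynomial with sum_k (x + k pi)^-m = (cotpoly R m).[cot x] for 1 < m;
   the recursion is differentiation in x, divided by - m. *)
Fixpoint cotpoly (R : realType) (m : nat) : {poly R} :=
  if m is m'.+1 then
    if m' == 0%N then 'X
    else m'%:R^-1 *: ((1 + 'X ^+ 2) * (cotpoly R m')^`())
  else 0.
Arguments cotpoly : simpl never.

Section CotPolynomials.
Variable R : realType.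
Local Notation cotpoly := (cotpoly R).
Local Notation D P := ((1 + 'X ^+ 2) * P^`()).

Lemma D_cotpoly m : (0 < m)%N -> D (cotpoly m) = m%:R *: cotpoly m.+1.
Proof.
case: m => // m _; rewrite /cotpoly /= -/cotpoly scalerA mulfV ?scale1r //.
Qed.

Lemma D2_cotpoly a m : (0 < m)%N ->
  D (D (a *: cotpoly m)) = (a * (m%:R * m.+1%:R)) *: cotpoly m.+2.
Proof.
move=> m0; rewrite derivZ -scalerAr (D_cotpoly m0) scalerA derivZ -scalerAr.
by rewrite D_cotpoly // scalerA mulrA.
Qed.

Lemma D_csc n : D ((1 + 'X ^+ 2) ^+ n) =
  (2 * n)%:R *: ('X * (1 + 'X ^+ 2) ^+ n) :> {poly R}.
Proof.
case: n => [|n]; first by rewrite !muln0 expr0 derivC mulr0 scale0r.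
rewrite deriv_exp derivD derivC derivXn expr1 -!mul_polyC !rmorph_nat /=.
rewrite [_ ^+ n.+1]exprS; ring.
Qed.

(** Since [D] acts as -d/dx on polynomials in cot x, this is the second derivative of csc^2n. It
    expresses csc^(2n+2) through csc^2n and its second derivative, which drives the induction of
    [csc_cotpoly]. *)
Lemma D2_csc n : D (D ((1 + 'X ^+ 2) ^+ n)) =
  (2 * n * (2 * n).+1)%:R *: (1 + 'X ^+ 2) ^+ n.+1
  - (2 * n * (2 * n))%:R *: (1 + 'X ^+ 2) ^+ n :> {poly R}.
Proof.
rewrite D_csc derivZ derivM derivX -scalerAr mulrDr.
rewrite [X in _ + X]mulrCA D_csc -!mul_polyC !rmorph_nat [_ ^+ n.+1]exprS; ring.
Qed.

Lemma csc_cotpoly n : (0 < n)%N -> exists c : nat -> R,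
  (1 + 'X ^+ 2) ^+ n = \sum_(1 <= i < n.+1) c i *: cotpoly (2 * i).
Proof.
case: n => // n _; elim: n => [|n [c IH]].
  exists (fun=> 1); rewrite big_nat1 expr1 scale1r muln1 /cotpoly /=.
  by rewrite invr1 scale1r derivX mulr1.
pose k : R := (2 * n.+1 * (2 * n.+1).+1)%:R.
have k0 : k != 0 by rewrite pnatr_eq0; lia.
(* Solving [D2_csc] for the higher power adds two contributions to the coefficient at i: the old
   term at i, and the old term at i - 1 moved up by [D2_cotpoly]. The two conditionals discard the
   indices i = n + 2 and i = 1, where the respective contribution is absent. *)
exists (fun i => k^-1 *
  ((if (i <= n.+1)%N then (2 * n.+1 * (2 * n.+1))%:R * c i else 0) +
   (if (1 < i)%N then (2 * i.-1 * (2 * i.-1).+1)%:R * c i.-1 else 0))).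
have := D2_csc n.+1; rewrite -/k => /eqP.
rewrite eq_sym subr_eq => /eqP/(congr1 (GRing.scale k^-1)).
rewrite scalerA mulVf // scale1r => ->.
under [RHS]eq_bigr do rewrite -scalerA scalerDl.
rewrite -scaler_sumr big_split /= addrC; congr (_ *: (_ + _)).
- rewrite [RHS]big_nat_recl //= scale0r add0r IH.
  rewrite !(raddf_sum, mulr_sumr); apply: eq_big_nat => i /andP[i0 _].
  by rewrite ltnS i0 /= D2_cotpoly ?muln_gt0 // -natrM mulrC (mulnS 2 i).

- rewrite [RHS]big_nat_recr //=. rewrite ltnn scale0r addr0 IH scaler_sumr.
  by apply: eq_big_nat => i /andP[_ iln]; rewrite -ltnS iln scalerA.
Qed.

(** Apply [D] once to the expansion of csc^2n: the left side gains 2n cot x, and each term gains 2i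
    while its index rises by one. The ratio of the two factors is i / n. *)
Lemma cotcsc_cotpoly n (c : nat -> R) : (0 < n)%N ->
  (1 + 'X ^+ 2) ^+ n = \sum_(1 <= i < n.+1) c i *: cotpoly (2 * i) ->
  'X * (1 + 'X ^+ 2) ^+ n =
    \sum_(1 <= i < n.+1) (n%:R^-1 * (i%:R * c i)) *: cotpoly (2 * i).+1.
Proof.
move=> n0 E; have n1 : (2 * n)%:R != 0 :> R by rewrite pnatr_eq0; lia.
have := D_csc n; rewrite {1}E => /(congr1 (GRing.scale (2 * n)%:R^-1)).
rewrite scalerA mulVf // scale1r => <-.
rewrite !(raddf_sum, mulr_sumr, scaler_sumr).
apply: eq_big_nat => i /andP[i0 _].
rewrite /= derivZ -scalerAr D_cotpoly ?muln_gt0 // !scalerA !natrM.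
congr (_ *: _); field.
by rewrite pnatr_eq0 -lt0n.
Qed.

(* The duplication formula of q(cot x), written with t = cot (x / 2),
   so that -1/t = cot ((x + pi) / 2) and (t - 1/t) / 2 = cot x; it is stable
   under P |-> (1 + X^2) P'. *)
Lemma cotpoly_dup m (t : R) : (0 < m)%N -> t != 0 ->
  (cotpoly m).[t] + (cotpoly m).[- t^-1] =
  2 ^+ m * (cotpoly m).[(t - t^-1) / 2].
Proof.
case: m => // m _; elim: m t => [|m IH] t t0.
  by rewrite /= !hornerX expr1; field.
pose q := cotpoly m.+1.
have dV : is_derive t 1 (fun x : R => - x^-1) (t ^- 2).
  have H := is_deriveN (is_deriveV t0 (is_derive_id t 1)).
  by apply: (is_derive_eq H); rewrite scaleNr opprK /GRing.scale /= mulr1.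
have dw : is_derive t 1 (fun x : R => (x - x^-1) / 2) ((1 + t ^- 2) / 2).
  have H := is_deriveZ 2^-1 (is_deriveD (is_derive_id t 1) dV).
  rewrite (_ : (fun _ => _) = (2^-1 \*: (id + (fun x : R => - x^-1)))); last first.
    by apply/funext => x /=; rewrite mulrC.
  by apply: (is_derive_eq H); rewrite /GRing.scale /= mulrC.
have dl := is_deriveD (is_derive_poly q t)
  (is_derive1_comp (g := fun x => - x^-1) (is_derive_poly q (- t^-1)) dV).
have dr := is_deriveZ (2 ^+ m.+1)
  (is_derive1_comp (g := fun x => (x - x^-1) / 2)
    (is_derive_poly q ((t - t^-1) / 2)) dw).
(* The induction hypothesis holds on a neighbourhood of t, so both sides have the same derivative at
   t. *)
have E : \forall x \near t, (horner q + (horner q \o (fun x : R => - x^-1))) x =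
    (2 ^+ m.+1 \*: (horner q \o (fun x : R => (x - x^-1) / 2))) x.
  near=> x; rewrite /=; apply: IH.
  by near: x; exact: (cvgr_neq0 _ cvg_id t0).
have {dl dr}: q^`().[t] + q^`().[- t^-1] * t ^- 2 =
    2 ^+ m.+1 * (q^`().[(t - t^-1) / 2] * ((1 + t ^- 2) / 2)).
  have := near_eq_is_derive E dl => - [_ <-].
  by case: dr => _ ->.
have k0 : m.+1%:R != 0 :> R by rewrite pnatr_eq0.
have qS y : (cotpoly m.+2).[y] = m.+1%:R^-1 * ((1 + y ^+ 2) * q^`().[y]).
  by rewrite /cotpoly /= -/cotpoly hornerZ hornerM !hornerE.
rewrite !qS => H.
(* With w = (t - 1/t) / 2, the factor 1 + t^2 turns t^-2 into 1 + t^-2 and w' into 2 (1 + w^2). This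
   restores the recursion at all three points and supplies the extra factor 2. *)
transitivity (m.+1%:R^-1 *
  ((1 + t ^+ 2) * (q^`().[t] + q^`().[- t^-1] * t ^- 2))); first by field; rewrite t0 nat1r.
by rewrite H [_ ^+ m.+2]exprS; field; rewrite t0 nat1r.
Unshelve. all: by end_near. Qed.

End CotPolynomials.

(** * Germs of analytic functions *)

Section Germs.
Variable R : realType.
Implicit Types (a b : nat -> R) (F G : R -> R).

Lemma geometric_tail (q : R) m n : 0 <= q <= 2^-1 ->
  \sum_(m <= j < n) q ^+ j <= 2 * q ^+ m.
Proof.
move=> /andP[q0 q1]; have [nm|mn] := leqP n m.
  by rewrite big_geq // mulr_ge0 // exprn_ge0.
suff : \sum_(m <= j < n) q ^+ j <= 2 * (q ^+ m - q ^+ n).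
  by move/le_trans; apply; rewrite ler_wpM2l // gerBl exprn_ge0.
elim: n mn => // n IH; rewrite ltnS leq_eqVlt => /orP[/eqP <-|mn].
  by rewrite big_nat1 exprS; have := exprn_ge0 m q0; nra.
rewrite big_nat_recr /=; last exact: ltnW.
by have := IH mn; rewrite exprS; have := exprn_ge0 n q0; nra.
Qed.

(* One constant serves both as amplitude and as inverse radius. *)
Definition coef_bound (C : R) a := 1 <= C /\ forall j, `|a j| <= C ^+ j.+1.

Lemma coef_boundW C C' a : C <= C' -> coef_bound C a -> coef_bound C' a.
Proof.
move=> CC' [C1 Ca]; split; first exact: le_trans CC'.
move=> j; apply: le_trans (Ca j) _; apply: lerXn2r => //;
  by rewrite nnegrE; lra.
Qed.

(** The terms of a convergent series are bounded by some M, so |a_j| <= M |x|^-j; any C above 1, M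
    and 1/|x| works. *)
Lemma cvg_coef_bound a (x : R) : x != 0 ->
  cvgn (series (fun j => a j * x ^+ j)) -> exists C, coef_bound C a.
Proof.
move=> x0 /cvg_series_bounded/pinfty_ex_gt0[M M0 /= aM].
exists (Num.max 1 (Num.max M `|x|^-1)); set C := Num.max _ _.
have C1 : 1 <= C by rewrite le_max lexx.
have CM : M <= C by rewrite !le_max lexx orbT.
have Cx : `|x|^-1 <= C by rewrite !le_max lexx !orbT.
split=> // j; have := aM j I; rewrite normrM normrX.
rewrite -ler_pdivlMr ?exprn_gt0 ?normr_gt0 // => /le_trans; apply.
rewrite exprS ler_pM ?invr_ge0 ?exprn_ge0 ?(ltW M0) // -exprVn.
by apply: lerXn2r => //; rewrite nnegrE ?invr_ge0 //; lra.
Qed.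

Lemma coef_bound_term C a (x : R) j : coef_bound C a ->
  `|a j * x ^+ j| <= C * (C * `|x|) ^+ j.
Proof.
move=> [_ Ca]; rewrite normrM normrX exprMn mulrA -exprS.
by rewrite ler_wpM2r // exprn_ge0.
Qed.

Lemma coef_bound_cvg C a (x : R) : coef_bound C a -> C * `|x| <= 2^-1 ->
  cvgn (series (fun j => a j * x ^+ j)).
Proof.
move=> Ca Cx; have C0 : 0 <= C by case: Ca; lra.
apply: normed_cvg => /=.
apply: (@series_le_cvg _ _ (geometric C (C * `|x|))) => //= [n|n|].
- by rewrite mulr_ge0 // exprn_ge0 // mulr_ge0.
- exact: coef_bound_term.
- by apply: is_cvg_geometric_series; rewrite ger0_norm ?mulr_ge0 //; lra.
Qed.

Lemma coef_bound_tail C a (x l : R) m : coef_bound C a -> C * `|x| <= 2^-1 ->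
  series (fun j => a j * x ^+ j) @ \oo --> l ->
  `|l - \sum_(0 <= j < m) a j * x ^+ j| <= 2 * C * (C * `|x|) ^+ m.
Proof.
move=> Ca Cx al; have C0 : 0 <= C by case: Ca; lra.
apply: (cvgr_to_le (cvg_norm (cvgB al (cvg_cst _)))); near=> n.
have mn : (m <= n)%N by near: n; exact: nbhs_infty_ge.
rewrite /series /= fctE (big_cat_nat (leq0n m) mn) /= addrAC subrr add0r.
apply: le_trans (ler_norm_sum _ _ _) _.
apply: (@le_trans _ _ (\sum_(m <= j < n) C * (C * `|x|) ^+ j)).
  by apply: ler_sum => j _; exact: coef_bound_term.
rewrite -mulr_sumr [2 * C]mulrC -mulrA ler_wpM2l //.
by apply: geometric_tail; rewrite Cx mulr_ge0.
Unshelve. all: by end_near. Qed.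

(* F agrees near 0, but not necessarily at 0, with a convergent power series
   whose constant term is c. *)
Definition analytic0 F (c : R) := exists2 a, a 0%N = c &
  \forall x \near 0^', series (fun j => a j * x ^+ j) @ \oo --> F x.

Lemma series_coef_bound a F :
  (\forall x \near 0^', series (fun j => a j * x ^+ j) @ \oo --> F x) ->
  exists C, coef_bound C a.
Proof.
move=> aF; near (0 : R)^' => x.
have x0 : x != 0 by near: x; exact: nbhs_dnbhs_neq.
by apply: cvg_coef_bound x0 _; apply/cvg_ex; exists (F x); near: x.
Unshelve. all: by end_near. Qed.

(** The threshold 1/8 makes 2 C |x| <= 1/4, the ratio needed for Cauchy products in
    [series_conv]. *)
Lemma near_bound_small (C : R) : \forall x \near (0 : R)^', C * `|x| <= 8^-1.
Proof.
have [C0|C0] := ltP 0 C; near=> x.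
  rewrite mulrC -ler_pdivlMr //; apply: ltW; near: x; apply: dnbhs0_lt.
  by rewrite divr_gt0 ?invr_gt0.
by apply: (@le_trans _ _ 0); rewrite ?mulr_le0_ge0 ?invr_ge0.
Unshelve. all: by end_near. Qed.

Lemma analytic0_ext F G c : (\forall x \near 0^', F x = G x) ->
  analytic0 F c -> analytic0 G c.
Proof.
move=> FG [a a0 aF]; exists a => //.
by apply: filterS2 FG aF => x ->.
Qed.

Lemma analytic0_cst c : analytic0 (fun=> c) c.
Proof.
exists (fun j => if j == 0%N then c else 0) => //; near=> x.
rewrite -cvg_shiftS; apply: cvg_near_cst; near=> n; apply/eqP.
rewrite /series /= big_nat_recl //= expr0 mulr1 big1 ?addr0 // => i _.
by rewrite mul0r.
Unshelve. all: by end_near. Qed.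

Lemma analytic0_id : analytic0 id 0.
Proof.
exists (fun j => if j == 1%N then 1 else 0) => //; near=> x.
rewrite -cvg_shiftS -cvg_shiftS; apply: cvg_near_cst; near=> n; apply/eqP.
rewrite /series /= !big_nat_recl //= mul0r add0r mul1r expr1.
by rewrite big1 ?addr0 // => i _; rewrite mul0r.
Unshelve. all: by end_near. Qed.

Lemma analytic0D F G c d : analytic0 F c -> analytic0 G d ->
  analytic0 (fun x => F x + G x) (c + d).
Proof.
move=> [a <- aF] [b <- bG]; exists (fun j => a j + b j) => //.
apply: filterS2 aF bG => x aF bG.
rewrite (_ : series _ = series (fun j => a j * x ^+ j) + series (fun j => b j * x ^+ j)).
  exact: cvgD.
by rewrite -seriesD; congr series; apply/funext => j /=; rewrite mulrDl.
Qed.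

Definition conv a b (k : nat) := \sum_(i < k.+1) a i * b (k - i)%N.

(** Each of the k + 1 products is at most C^(k+2), and k + 1 <= 2^k. *)
Lemma conv_bound C a b k : coef_bound C a -> coef_bound C b ->
  `|conv a b k| <= C ^+ 2 * (2 * C) ^+ k.
Proof.
move=> [C1 Ca] [_ Cb]; have C0 : 0 <= C by lra.
apply: le_trans (ler_norm_sum _ _ _) _.
apply: (@le_trans _ _ (\sum_(i < k.+1) C ^+ k.+2)).
  apply: ler_sum => i _; rewrite normrM.
  have -> : k.+2 = (i.+1 + (k - i).+1)%N by have := ltn_ord i; lia.
  by rewrite exprD ler_pM.
rewrite sumr_const card_ord -[leLHS]mulr_natl exprMn [leRHS]mulrCA -exprD add2n.
rewrite ler_wpM2r ?exprn_ge0 // -natrX ler_nat; exact: ltn_expl.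
Qed.

(** The n-th partial sums are values of polynomials p and q. Below degree n the coefficients of pq
    are those of the Cauchy product, so the difference consists of the terms of pq of degree at
    least n, a geometric tail. Truncation preserves [coef_bound], so [conv_bound] applies to p and
    q. *)
Lemma series_conv C a b (x : R) : coef_bound C a -> coef_bound C b ->
  C * `|x| <= 8^-1 ->
  (fun n => series (fun j => a j * x ^+ j) n * series (fun j => b j * x ^+ j) n
   - series (fun k => conv a b k * x ^+ k) n) @ \oo --> (0 : R).
Proof.
move=> Ca Cb Cx; have C0 : 0 <= C by case: Ca; lra.
have Cx0 : 0 <= C * `|x| by rewrite mulr_ge0.
have cp (d : nat -> R) n : coef_bound C d ->
    coef_bound C (fun i => (\poly_(j < n) d j)`_i).
  move=> [C1 Cd]; split => // i; rewrite coef_poly; case: ifP => // _.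
  by rewrite normr0 exprn_ge0.
apply: norm_cvg0.
apply: (@squeeze_cvgr _ _ _ _ (fun=> 0) (geometric (C ^+ 2 * 2) 4^-1)).
- near=> n; rewrite normr_ge0 /=.
  pose p := \poly_(j < n) a j; pose q := \poly_(j < n) b j.
  have cE k : (p * q)`_k = conv (fun i => p`_i) (fun i => q`_i) k.
    by rewrite coefM.
  have -> : series (fun j => a j * x ^+ j) n * series (fun j => b j * x ^+ j) n
     - series (fun k => conv a b k * x ^+ k) n =
     \sum_(n <= k < n + n) (p * q)`_k * x ^+ k.
    have -> : series (fun j => a j * x ^+ j) n = p.[x].
      by rewrite horner_poly /series /= big_mkord.
    have -> : series (fun j => b j * x ^+ j) n = q.[x].
      by rewrite horner_poly /series /= big_mkord.
    rewrite -hornerM (@horner_coef_wide _ (n + n)); last first.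
      apply: leq_trans (size_polyMleq _ _) _.
      by apply: leq_trans (leq_pred _) _; rewrite leq_add // size_poly.
    rewrite -(big_mkord xpredT (fun k => (p * q)`_k * x ^+ k)).
    rewrite (big_cat_nat (leq0n n) (leq_addr n n)) /= addrAC.
    rewrite [X in X - _](_ : _ = series (fun k => conv a b k * x ^+ k) n).
      by rewrite subrr add0r.
    apply: eq_big_nat => k /andP[_ kn]; rewrite coefM; congr (_ * _).
    apply: eq_bigr => i _; rewrite !coef_poly.
    by rewrite (leq_ltn_trans _ kn) ?leq_ord // (leq_ltn_trans _ kn) ?leq_subr.
  apply: le_trans (ler_norm_sum _ _ _) _.
  apply: (@le_trans _ _ (\sum_(n <= k < n + n) C ^+ 2 * 4^-1 ^+ k)).
    apply: ler_sum => k _; rewrite normrM normrX cE.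
    apply: le_trans (ler_wpM2r _ (conv_bound k (cp a n Ca) (cp b n Cb))) _.
      exact: exprn_ge0.
    rewrite -mulrA -exprMn ler_wpM2l ?exprn_ge0 //.
    by apply: lerXn2r; rewrite ?nnegrE -?mulrA ?mulr_ge0 // ?invr_ge0 //; lra.
  rewrite -mulr_sumr -[leRHS]mulrA ler_wpM2l ?exprn_ge0 //.
  by apply: geometric_tail; lra.
- exact: cvg_cst.
- by apply: cvg_geometric; rewrite ger0_norm //; lra.
Unshelve. all: by end_near. Qed.

Lemma analytic0M F G c d : analytic0 F c -> analytic0 G d ->
  analytic0 (fun x => F x * G x) (c * d).
Proof.
move=> [a <- aF] [b <- bG]; exists (conv a b).
  by rewrite /conv big_ord1.
have [C1 aC1] := series_coef_bound aF; have [C2 bC2] := series_coef_bound bG.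
pose C := Num.max C1 C2.
have aC : coef_bound C a by apply: coef_boundW aC1; rewrite le_max lexx.
have bC : coef_bound C b by apply: coef_boundW bC2; rewrite le_max lexx orbT.
near=> x.
have Cx : C * `|x| <= 8^-1 by near: x; exact: near_bound_small.
have Fx : series (fun j => a j * x ^+ j) @ \oo --> F x by near: x.
have Gx : series (fun j => b j * x ^+ j) @ \oo --> G x by near: x.
have := cvgB (cvgM Fx Gx) (series_conv aC bC Cx); rewrite subr0.
set u := (X in X x @[x --> _] --> _).
have -> : u = series (fun k => conv a b k * x ^+ k).
  by apply/funext => n; rewrite /u !fctE subKr.
exact.
Unshelve. all: by end_near. Qed.

Lemma analytic0X F c n : analytic0 F c -> analytic0 (fun x => F x ^+ n) (c ^+ n).
Proof.
move=> aF; elim: n => [|n IH]; first exact: analytic0_cst.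
rewrite exprS; apply: analytic0_ext (analytic0M aF IH).
by near=> x; rewrite exprS.
Unshelve. all: by end_near. Qed.

Lemma analytic0_sum n (F : nat -> R -> R) (c : nat -> R) :
  (forall i, analytic0 (F i) (c i)) ->
  analytic0 (fun x => \sum_(i < n) F i x) (\sum_(i < n) c i).
Proof.
move=> aF; elim: n => [|n IH].
  rewrite big_ord0; apply: analytic0_ext (analytic0_cst 0).
  by near=> x; rewrite big_ord0.
rewrite big_ord_recr; apply: analytic0_ext (analytic0D IH (aF n)).
by near=> x; rewrite big_ord_recr.
Unshelve. all: by end_near. Qed.

(* Only the indices j <= n are meaningful in inv_upto a n j. *)
Fixpoint inv_upto a (n : nat) : nat -> R :=
  if n is n'.+1 then fun j =>
    if j == n then - \sum_(i < n) a (n - i)%N * inv_upto a n' i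
    else inv_upto a n' j
  else fun=> 1.

Definition inv_coef a (n : nat) : R := inv_upto a n n.

Lemma inv_uptoE a n j : (j <= n)%N -> inv_upto a n j = inv_coef a j.
Proof.
elim: n j => [|n IH] j; first by rewrite leqn0 => /eqP ->.
rewrite leq_eqVlt => /orP[/eqP -> //|jn].
by rewrite /= (ltn_eqF jn) IH.
Qed.

Lemma inv_coefS a n :
  inv_coef a n.+1 = - \sum_(i < n.+1) a (n.+1 - i)%N * inv_coef a i.
Proof.
rewrite {1}/inv_coef /= eqxx; congr (- _).
by apply: eq_bigr => i _; rewrite inv_uptoE // -ltnS.
Qed.

Lemma conv_inv_coef a n : a 0%N = 1 -> conv (inv_coef a) a n.+1 = 0.
Proof.
move=> a0; rewrite /conv big_ord_recr /= subnn a0 mulr1 inv_coefS.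
by apply/eqP; rewrite subr_eq0; apply/eqP/eq_bigr => i _; rewrite mulrC.
Qed.

(** By the recursion each new coefficient is at most the sum of the absolute values of all earlier
    ones, so that sum at most doubles at every step. *)
Lemma inv_coef_bound a : (forall j, `|a j| <= 1) -> coef_bound 2 (inv_coef a).
Proof.
move=> a1; split=> [|n]; first lra.
suff H : \sum_(i < n.+1) `|inv_coef a i| <= 2 ^+ n.
  rewrite big_ord_recr /= in H; rewrite exprS.
  have := exprn_ge0 n (ler0n R 2).
  have : 0 <= \sum_(i < n) `|inv_coef a i| by apply: sumr_ge0.
  by lra.
elim: n => [|n IH]; first by rewrite big_ord1 expr0 /inv_coef /= normr1.
rewrite big_ord_recr /= exprS mulr_natl mulr2n lerD // inv_coefS normrN.
apply: le_trans (ler_norm_sum _ _ _) _; apply: le_trans IH.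
by apply: ler_sum => i _; rewrite normrM ler_piMl.
Qed.

Lemma analytic0V F a : a 0%N = 1 -> (forall j, `|a j| <= 1) ->
  (\forall x \near 0^', series (fun j => a j * x ^+ j) @ \oo --> F x) ->
  analytic0 (fun x => (F x)^-1) 1.
Proof.
move=> a0 a1 aF; exists (inv_coef a) => //.
have aC : coef_bound 2 a.
  by split=> [|j]; [lra|apply: le_trans (a1 j) (exprn_ege1 _ _); lra].
have bC := inv_coef_bound a1.
near=> x.
have Cx : 2 * `|x| <= 8^-1 by near: x; exact: near_bound_small.
have Fx : series (fun j => a j * x ^+ j) @ \oo --> F x by near: x.
have /cvg_ex[l bl] : cvgn (series (fun j => inv_coef a j * x ^+ j)).
  by apply: coef_bound_cvg bC _; lra.
(* This equation also shows that F x is nonzero, so l is its inverse. It holds because the Cauchy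
   product of the two series is the constant series 1. *)
suff E : l * F x = 1.
  by rewrite -[(F x)^-1]mul1r -E mulfK // -?E //; apply/eqP => F0;
     move: E; rewrite F0 mulr0 => /eqP; rewrite eq_sym oner_eq0.
have := cvgB (cvgM bl Fx) (series_conv bC aC Cx); rewrite subr0.
set u := (X in X x @[x --> _] --> _).
have -> : u = series (fun k => conv (inv_coef a) a k * x ^+ k).
  by apply/funext => n; rewrite /u !fctE subKr.
move=> /(_ _ _) lF; apply: (cvg_unique (@Rhausdorff R) lF).
rewrite /= -cvg_shiftS; apply: cvg_near_cst; near=> n; apply/eqP.
rewrite /series /= big_nat_recl // expr0 mulr1 /conv big_ord1.
rewrite a0 mulr1 big1 ?addr0 // => i _.
by rewrite -/(conv _ _ _) conv_inv_coef // mul0r.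
Unshelve. all: by end_near. Qed.

End Germs.

(** * Principal parts and Laurent coefficients *)

Section PrincipalParts.
Variable R : realType.
Implicit Types (f g : R -> R) (P Q : {poly R}).

Lemma analytic0_cos : analytic0 (@cos R) 1.
Proof.
exists (fun j => (~~ odd j)%:R * (-1) ^+ j./2 / j`!%:R) => /=.
  by rewrite !mul1r invr1.
near=> x; have H := @is_cvg_series_cos_coeff _ x.
have -> : cos x = limn (series (cos_coeff x)) by rewrite cos_coeffE cosE.
by rewrite -cos_coeffE.
Unshelve. all: by end_near. Qed.

(** Inverse of sin x / x, whose coefficients start with 1 and are bounded by 1 in absolute value, as
    [analytic0V] requires. *)
Lemma analytic0_x_sin : analytic0 (fun x : R => x / sin x) 1.
Proof.
pose a (j : nat) : R := (odd j.+1)%:R * (-1) ^+ j./2 / j.+1`!%:R.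
apply: (@analytic0_ext _ (fun x => (sin x / x)^-1)).
  by near=> x; rewrite invf_div.
apply: (@analytic0V _ _ a).
- by rewrite /a !mul1r invr1.
- move=> j; rewrite !normrM normrX normrN1 expr1n mulr1 normfV !normr_nat.
  apply: mulr_ile1; rewrite ?invr_ge0 //; first by rewrite lern1; case: odd.
  by rewrite invf_le1 ?ltr0n ?ler1n fact_gt0.
near=> x.
have x0 : x != 0 by near: x; exact: nbhs_dnbhs_neq.
have H : series (sin_coeff x) @ \oo --> sin x.
  have -> : sin x = limn (series (sin_coeff x)) by rewrite sin_coeffE sinE.
  exact: is_cvg_series_sin_coeff.
rewrite -cvg_shiftS in H; have := cvgM H (cvg_cst x^-1).
set u := (X in X y @[y --> _] --> _).
have -> : u = series (fun j => a j * x ^+ j); last exact.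
apply/funext => n; rewrite /u /= /series /= big_nat_recl // sin_coeffE /=.
rewrite !mul0r add0r mulr_suml; apply: eq_bigr => j _.
by rewrite exprSr /a mulrA mulfK.
Unshelve. all: by end_near. Qed.

(** If P X + c is bounded at 1/x, then P(1/x) is x times a bounded quantity. It is therefore
    bounded, so P is constant by induction; letting x tend to 0, that constant is 0. *)
Lemma bounded_poly_const P B :
  (\forall x \near 0^', `|P.[x^-1]| <= B) -> (size P <= 1)%N.
Proof.
elim/poly_ind: P B => [|P c IH] B PB; first by rewrite size_poly0.
have Pc : (size P <= 1)%N.
  apply: (IH (B + `|c|)); near=> x.
  have x1 : `|x| <= 1 by near: x; exact: dnbhs0_le.
  have x0 : x != 0 by near: x; exact: nbhs_dnbhs_neq.
  have : `|(P * 'X + c%:P).[x^-1]| <= B by near: x.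
  rewrite !hornerE => PBx.
  have -> : P.[x^-1] = x * ((P.[x^-1] * x^-1 + c) - c) by field.
  rewrite normrM; apply: (@le_trans _ _ (1 * (B + `|c|))); last by rewrite mul1r.
  by rewrite ler_pM //; apply: le_trans (ler_normB _ _) _; rewrite lerD2r.
move: PB; rewrite (size1_polyC Pc) => PB.
suff -> : P`_0 = 0 by rewrite polyC0 mul0r add0r size_polyC; case: eqP.
apply: contrapT => /eqP p0.
near (0 : R)^' => x.
have x0 : x != 0 by near: x; exact: nbhs_dnbhs_neq.
have : `|((P`_0)%:P * 'X + c%:P).[x^-1]| <= B by near: x.
rewrite !hornerE => PBx.
have D0 : 0 < `|B| + `|c| + 1 by rewrite ltr_wpDl ?addr_ge0.
have : `|x| < `|P`_0| / (`|B| + `|c| + 1).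
  near: x; apply: dnbhs0_lt; by rewrite divr_gt0 ?normr_gt0.
rewrite ltr_pdivlMr //; apply/negP; rewrite -leNgt.
have E : P`_0 = x * ((P`_0 * x^-1 + c) - c) by field.
rewrite [in leLHS]E normrM ler_wpM2l //; apply: le_trans (ler_normB _ _) _.
have := ler_norm B; lra.
Unshelve. all: by end_near. Qed.

(* P, evaluated at 1/x, is the principal part of f at 0. *)
Definition ppart f P := exists B, \forall x \near 0^', `|f x - P.[x^-1]| <= B.

Lemma ppart_ext f g P : (\forall x \near 0^', f x = g x) ->
  ppart f P -> ppart g P.
Proof. by move=> fg [B fP]; exists B; apply: filterS2 fg fP => x ->. Qed.

Lemma ppartB f g P Q : ppart f P -> ppart g Q ->
  ppart (fun x => f x - g x) (P - Q).
Proof.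
move=> [B fP] [C gQ]; exists (B + C); apply: filterS2 fP gQ => x fP gQ.
have -> : f x - g x - (P - Q).[x^-1] = (f x - P.[x^-1]) - (g x - Q.[x^-1]).
  by rewrite !hornerE; ring.
by apply: le_trans (ler_normB _ _) _; exact: lerD.
Qed.

Lemma ppartZ f P (k : R) : ppart f P -> ppart (fun x => k * f x) (k *: P).
Proof.
move=> [B fP]; exists (`|k| * B); apply: filterS fP => x fP.
by rewrite hornerZ -mulrBr normrM ler_wpM2l.
Qed.

Lemma ppart0 f B : (\forall x \near 0^', `|f x| <= B) -> ppart f 0.
Proof. by move=> fB; exists B; apply: filterS fB => x; rewrite horner0 subr0. Qed.

Lemma ppart_sum (I : eqType) (r : seq I) (F : I -> R -> R) (p : I -> {poly R}) :
  (forall i, i \in r -> ppart (F i) (p i)) ->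
  ppart (fun x => \sum_(i <- r) F i x) (\sum_(i <- r) p i).
Proof.
elim: r => [|i r IH] Fp.
  rewrite big_nil; apply: (@ppart0 _ 0); near=> x.
  by rewrite big_nil normr0.
have := ppartB (Fp i (mem_head _ _))
  (ppartZ (-1) (IH (fun j jr => Fp j (@mem_behead _ (i :: r) _ jr)))).
rewrite scaleN1r opprK big_cons; apply: ppart_ext; near=> x.
by rewrite big_cons mulN1r opprK.
Unshelve. all: by end_near. Qed.

(* Principal parts are only determined up to an additive constant. *)
Lemma ppart_uniq f P Q i : ppart f P -> ppart f Q -> (0 < i)%N -> P`_i = Q`_i.
Proof.
move=> fP fQ i0; have [B] := ppartB fP fQ.
move=> PQ; have {}PQ : \forall x \near 0^', `|(P - Q).[x^-1]| <= B.
  by apply: filterS PQ => x; rewrite subrr sub0r normrN.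
have /leq_sizeP/(_ i i0) := bounded_poly_const PQ.
by rewrite coefB => /eqP; rewrite subr_eq0 => /eqP.
Qed.

(** The remainder of the power series after m terms is O(x^m), so dividing by x^m leaves a bounded
    error. *)
Lemma ppart_series f m (a : nat -> R) :
  (\forall x \near 0^', series (fun j => a j * x ^+ j) @ \oo --> x ^+ m * f x) ->
  ppart f (\sum_(j < m) a j *: 'X^(m - j)).
Proof.
move=> af; have [C aC] := series_coef_bound af; have C0 : 0 <= C by case: aC; lra.
exists (2 * C * C ^+ m); near=> x.
have x0 : x != 0 by near: x; exact: nbhs_dnbhs_neq.
have Cx : C * `|x| <= 8^-1 by near: x; exact: near_bound_small.
have fx : series (fun j => a j * x ^+ j) @ \oo --> x ^+ m * f x by near: x.
have Cx2 : C * `|x| <= 2^-1 by lra.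
have := coef_bound_tail m aC Cx2 fx.
have -> : x ^+ m * f x - \sum_(0 <= j < m) a j * x ^+ j =
    x ^+ m * (f x - (\sum_(j < m) a j *: 'X^(m - j)).[x^-1]).
  rewrite mulrBr; congr (_ - _); rewrite horner_sum mulr_sumr big_mkord.
  apply: eq_bigr => j _; rewrite hornerZ hornerXn mulrCA; congr (_ * _).
  have jm := ltnW (ltn_ord j).
  by rewrite -{2}(subnKC jm) exprD -mulrA -exprMn mulfV // expr1n mulr1.
rewrite normrM normrX exprMn mulrA [leRHS]mulrC ler_pM2l // exprn_gt0 //.
by rewrite normr_gt0.
Unshelve. all: by end_near. Qed.

Lemma ppart_analytic0 f m c :
  analytic0 (fun x => x ^+ m * f x) c ->
  exists P, [/\ ppart f P, (size P <= m.+1)%N & (0 < m)%N -> P`_m = c].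
Proof.
move=> [a <- /ppart_series fP]; eexists; split; first exact: fP.
  apply: leq_trans (size_sum _ _ _) _; apply/bigmax_leqP => j _.
  apply: leq_trans (size_scale_leq _ _) _; rewrite size_polyXn ltnS.
  exact: leq_subr.
case: m {fP} => // m _; rewrite coef_sum big_ord_recl /= subn0.
rewrite coefZ coefXn eqxx mulr1 big1 ?addr0 // => j _.
rewrite coefZ coefXn /= /bump /= (_ : _ == _ = false) ?mulr0 //.
by apply/negbTE/eqP; have := ltn_ord j; lia.
Qed.

Lemma laurent_expansion_ppart f (c : int -> R) : laurent_expansion f c ->
  exists P, ppart f P /\ forall i, (0 < i)%N -> P`_i = c (- i%:Z).
Proof.
move=> [M [cM [r r0 fr]]].
exists (\sum_(j < M) c (j%:Z - M%:Z) *: 'X^(M - j)); split.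
  apply: (@ppart_series _ _ (fun j => c (j%:Z - M%:Z))); near=> x.
  have x0 : x != 0 by near: x; exact: nbhs_dnbhs_neq.
  have xr : 0 < `|x| < r.
    by rewrite normr_gt0 x0 /=; near: x; exact: dnbhs0_lt.
  have := cvgM (cvg_cst (x ^+ M)) (fr x xr).
  set u := (X in X y @[y --> _] --> _).
  have -> : u = series (fun j => c (j%:Z - M%:Z) * x ^+ j); last exact.
  apply/funext => n; rewrite /u /= /series /= mulr_sumr.
  apply: eq_bigr => j _; rewrite mulrCA; congr (_ * _).
  by rewrite -[x ^+ M]/(x ^ M%:Z) -expfzDr // addrC subrK.
(* Beyond the pole order M both sides vanish; otherwise only j = M - i contributes. *)
move=> i i0; rewrite coef_sum; have [iM|Mi] := leqP i M; last first.
  rewrite cM ?ltrN2 ?ltz_nat // big1 // => j _.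
  rewrite coefZ coefXn (_ : _ == _ = false) ?mulr0 //.
  by apply/negbTE/eqP; lia.
have jM : (M - i < M)%N by lia.
rewrite (bigD1 (Ordinal jM)) //= coefZ coefXn subKn // eqxx mulr1.
rewrite big1 ?addr0 => [|j /eqP ji].
  by congr c; lia.
rewrite coefZ coefXn (_ : _ == _ = false) ?mulr0 //.
apply/negbTE/eqP => E; apply: ji; apply: val_inj => /=; have := ltn_ord j; lia.
Unshelve. all: by end_near. Qed.

Lemma laurent_expansion_analytic0 f M c :
  analytic0 (fun x => x ^+ M * f x) c -> exists a, laurent_expansion f a.
Proof.
move=> [a _ af].
exists (fun k : int => if k < - M%:Z then 0 else a (absz (k + M%:Z))); exists M.
split=> [k ->//|].
have /nbhs_ballP[r /= r0 ar] := af.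
exists r => // x /andP[x0 xr]; set v := series _.
have {}x0 : x != 0 by rewrite -normr_gt0.
have {}ar := ar x; rewrite /ball /= sub0r normrN in ar.
have := cvgM (cvg_cst (x ^- M)) (ar xr x0).
rewrite mulKf ?expf_neq0 //.
have -> : v = (fun n => x ^- M * series (fun j => a j * x ^+ j) n); last exact.
apply/funext => n; rewrite /v /series /= mulr_sumr.
apply: eq_bigr => j _; rewrite ltNge lerBrDr addNr /= subrK absz_nat mulrCA.
by congr (_ * _); rewrite mulrC expfzDr // -exprnN.
Qed.

(** [laurent_coef] chooses some expansion, with a default value if there is none. Analyticity of x^M
    f guarantees that one exists, and uniqueness of principal parts makes the choice irrelevant at
    negative exponents. *)
Lemma laurent_coef_ppart f M c P i :
  analytic0 (fun x => x ^+ M * f x) c -> ppart f P -> (0 < i)%N ->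
  laurent_coef f (- i%:Z) = P`_i.
Proof.
move=> /laurent_expansion_analytic0[a fa] fP i0.
have : laurent_expansion f (laurent_coef f).
  by rewrite /laurent_coef; apply: (@xgetPex _ _ [set a | laurent_expansion f a]); exists a.
move=> /laurent_expansion_ppart[Q [fQ QE]].
by rewrite -QE //; exact: ppart_uniq fQ fP i0.
Qed.

End PrincipalParts.

(** * Partial fractions *)

Section Cotangent.
Variable R : realType.
Implicit Types (P : {poly R}) (x t : R).

Lemma poly_bounded P (A : R) :
  exists2 B, 0 <= B & forall y, `|y| <= A -> `|P.[y]| <= B.
Proof.
exists (\sum_(i < size P) `|P`_i| * `|A| ^+ i).
  by apply: sumr_ge0 => i _; rewrite mulr_ge0 ?exprn_ge0.
move=> y yA; rewrite horner_coef; apply: le_trans (ler_norm_sum _ _ _) _.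
apply: ler_sum => i _; rewrite normrM normrX ler_wpM2l //.
by apply: lerXn2r; rewrite ?nnegrE //; apply: le_trans yA (ler_norm _).
Qed.

Lemma size_cotpoly m : (size (cotpoly R m) <= m.+1)%N.
Proof.
elim: m => [|[|m] IH]; rewrite /cotpoly /= -/cotpoly ?size_poly0 ?size_polyX //.
apply: leq_trans (size_scale_leq _ _) _; apply: leq_trans (size_polyMleq _ _) _.
have s1 : (size (1 + 'X ^+ 2 : {poly R})%R <= 3)%N.
  apply: leq_trans (size_polyD _ _) _.
  by rewrite size_poly1 size_polyXn.
have s2 : (size (deriv (cotpoly R m.+1)) <= m.+1)%N.
  apply/leq_sizeP => j mj; rewrite coef_deriv nth_default ?mul0rn //.
  exact: leq_trans IH _.
by rewrite -subn1; exact: leq_trans (leq_sub2r 1 (leq_add s1 s2)) _.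
Qed.

Lemma lead_cotpoly m : (0 < m)%N -> (cotpoly R m)`_m = 1.
Proof.
case: m => // m _; elim: m => [|m IH]; first by rewrite /cotpoly coefX.
have := D_cotpoly R (ltn0Sn m) => /(congr1 (fun p : {poly R} => p`_m.+2)).
rewrite coefZ mulrDl mul1r coefD coefXnM /= !coef_deriv subn2 /= IH.
have -> : (cotpoly R m.+1)`_m.+3 = 0.
  by rewrite nth_default // (leq_trans (size_cotpoly _)).
rewrite mul0rn add0r => /esym H.
apply: (@mulfI _ m.+1%:R); rewrite ?pnatr_eq0 //.
by rewrite H mulr1.
Qed.

Lemma sin_neq0 x : 0 < `|x| < pi -> sin x != 0.
Proof.
case: (lerP 0 x) => x0; rewrite ?(ger0_norm x0) ?(ltr0_norm x0) => H.
  by rewrite gt_eqF // sin_gt0_pi.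
by rewrite -oppr_eq0 -sinN gt_eqF // sin_gt0_pi.
Qed.

Lemma cotBpi x : cot (x - pi) = cot x.
Proof. by rewrite /cot -[x in RHS](subrK pi) sinDpi cosDpi invrN mulrNN. Qed.

Lemma cot_half_shift x : cot ((x + pi) / 2) = - (cot (x / 2))^-1.
Proof. by rewrite /cot mulrDl sinDpihalf cosDpihalf invf_div mulNr. Qed.

Lemma cot_double x : sin (x / 2) != 0 -> cos (x / 2) != 0 ->
  cot x = (cot (x / 2) - (cot (x / 2))^-1) / 2.
Proof.
move=> s0 c0; have {1}-> : x = (x / 2) *+ 2 by rewrite mulr2n; field.
rewrite /cot cos_mulr2n sin_mulr2n.
have := cos2Dsin2 (x / 2) => E.
have -> : cos (x / 2) ^+ 2 *+ 2 - 1 = cos (x / 2) ^+ 2 - sin (x / 2) ^+ 2.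
  by lra.
by field; rewrite s0 c0.
Qed.

Lemma cotpoly_cot_dup m x : (0 < m)%N -> sin x != 0 ->
  (cotpoly R m).[cot (x / 2)] + (cotpoly R m).[cot ((x + pi) / 2)] =
  2 ^+ m * (cotpoly R m).[cot x].
Proof.
move=> m0 sx0.
have : sin ((x / 2) *+ 2) != 0.
  by rewrite (_ : _ *+ 2 = x) // mulr2n; field.
rewrite sin_mulr2n mulrn_eq0 /= mulf_eq0 negb_or => /andP[c0 s0].
rewrite cot_half_shift cotpoly_dup // ?(cot_double s0 c0) //.
by rewrite mulf_neq0 ?invr_neq0.
Qed.

Lemma dnbhs_half (p : R -> Prop) :
  (\forall x \near 0^', p x) -> \forall x \near 0^', p (x / 2).
Proof.
move=> /nbhs_ballP[r /= r0 rp]; near=> x.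
have x0 : x != 0 by near: x; exact: nbhs_dnbhs_neq.
apply: rp; last by rewrite mulf_neq0 ?invr_neq0.
rewrite /ball /= sub0r normrN normrM [`|2^-1|]ger0_norm ?invr_ge0 //.
have : `|x| < r by near: x; exact: dnbhs0_lt.
have := normr_ge0 x; lra.
Unshelve. all: by end_near. Qed.

Lemma near_sin_neq0 : \forall x \near (0 : R)^', sin x != 0.
Proof.
near=> x; apply: sin_neq0; rewrite normr_gt0; apply/andP; split.
  by near: x; exact: nbhs_dnbhs_neq.
by near: x; apply: dnbhs0_lt; exact: pi_gt0.
Unshelve. all: by end_near. Qed.

(** With q_i the coefficients of [cotpoly R m], the function is the sum of q_i (x cot x)^i x^(m-i).
    At 0 only the leading term i = m survives, and it is 1 by [lead_cotpoly]. *)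
Lemma analytic0_cotpoly m : (0 < m)%N ->
  analytic0 (fun x => x ^+ m * (cotpoly R m).[cot x]) 1.
Proof.
move=> m0; pose q := cotpoly R m.
have aF i : analytic0 (fun x => q`_i * (x / sin x * cos x) ^+ i * x ^+ (m - i))
    (q`_i * (1 * 1) ^+ i * 0 ^+ (m - i)).
  apply: analytic0M; last exact: analytic0X (analytic0_id R).
  apply: analytic0M; first exact: analytic0_cst.
  by apply: analytic0X; apply: analytic0M;
    [exact: analytic0_x_sin|exact: analytic0_cos].
have := analytic0_sum m.+1 aF.
rewrite big_ord_recr /= big1 => [|i _]; last first.
  by rewrite expr0n subn_eq0 leqNgt ltn_ord mulr0.
rewrite add0r subnn expr0 mulr1 mul1r expr1n mulr1 lead_cotpoly //.
apply: analytic0_ext; near=> x.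
have x0 : x != 0 by near: x; exact: nbhs_dnbhs_neq.
rewrite (horner_coef_wide _ (size_cotpoly m)) mulr_sumr; apply: eq_bigr => i _.
have im : (i <= m)%N by rewrite -ltnS.
rewrite -/q mulrCA -mulrA; congr (_ * _).
have -> : x ^+ m = x ^+ i * x ^+ (m - i) by rewrite -exprD subnKC.
rewrite [RHS]mulrAC -exprMn.
by congr (_ ^+ _ * _); rewrite /cot; ring.
Unshelve. all: by end_near. Qed.

Lemma ppart_eq (f : R -> R) P (Q : {poly R}) : ppart f P ->
  (forall i, (0 < i)%N -> P`_i = Q`_i) -> ppart f Q.
Proof.
move=> [B fP] PQ; exists (B + `|(P - Q)`_0|); apply: filterS fP => x fP.
have sPQ : (size (P - Q)%R <= 1)%N.
  by apply/leq_sizeP => i i0; rewrite coefB PQ ?subrr.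
have -> : f x - Q.[x^-1] = f x - P.[x^-1] + (P - Q).[x^-1].
  by rewrite hornerD hornerN addrA subrK.
rewrite (size1_polyC sPQ) hornerC; apply: le_trans (ler_normD _ _) _.
by rewrite coefC /= lerD2r.
Qed.

(* The duplication formula is homogeneous of degree m, so it kills every term
   of the principal part other than x^-m. *)
Lemma ppart_cotpoly m : (0 < m)%N ->
  ppart (fun x => (cotpoly R m).[cot x]) 'X^m.
Proof.
move=> m0; have [P [fP _ /(_ m0) Pm]] := ppart_analytic0 (analytic0_cotpoly m0).
apply: (ppart_eq fP) => i i0; rewrite coefXn.
case: eqP => [-> //|/eqP im].
pose f x := (cotpoly R m).[cot x].
have f2 : ppart (fun x => f (x / 2)) (\poly_(j < size P) (2 ^+ j * P`_j)).
  have [B /dnbhs_half fB] := fP; exists B; apply: filterS fB => x.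
  rewrite invf_div mulrC horner_poly; congr (`| _ - _ | <= _).
  rewrite horner_coef; apply: eq_bigr => j _.
  by rewrite exprMn; ring.
(* The second term of the duplication formula has no pole at 0, since cot ((x + pi) / 2) = - tan (x
   / 2). *)
have ft : ppart (fun x => (cotpoly R m).[cot ((x + pi) / 2)]) 0.
  have [B _ qB] := poly_bounded (cotpoly R m) 1.
  apply: (@ppart0 _ _ B).
  have : \forall x \near (0 : R)^', `|tan x| <= 1.
    apply: cvgr0_norm_le => //.
    rewrite -[X in _ --> X](@tan0 R); apply: cvg_within_filter.
    by apply: continuous_tan; rewrite cos0 oner_neq0.
  move/dnbhs_half; apply: filterS => x tx; apply: qB.
  by rewrite cot_half_shift normrN /cot invf_div.
have E := ppartB (ppartZ (2 ^+ m) fP) ft.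
have : ppart (fun x => f (x / 2)) (2 ^+ m *: P - 0).
  apply: ppart_ext E; near=> x; rewrite -cotpoly_cot_dup ?addrK //.
  by near: x; exact: near_sin_neq0.
move=> /(ppart_uniq f2)/(_ i0); rewrite subr0 coefZ coef_poly.
case: ltnP => iP; last by rewrite nth_default.
move/eqP; rewrite -subr_eq0 -mulrBl mulf_eq0 => /orP[|/eqP //].
by rewrite subr_eq0 -!natrX eqr_nat eqn_exp2l // => /eqP H; rewrite H eqxx in im.
Unshelve. all: by end_near. Qed.

(** Near 0 the bound comes from the principal part. Away from 0, |cot x| and 1/|x| are bounded,
    hence both terms are. The radius [r'] is capped at pi/2 so that sin is monotone where it is
    compared. *)
Lemma cotpoly_near_pole m : (0 < m)%N -> exists2 B, 0 <= B &
  forall x, 0 < `|x| <= pi / 2 -> `|(cotpoly R m).[cot x] - x ^- m| <= B.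
Proof.
move=> m0; have [B /nbhs_ballP[r /= r0 rB]] := ppart_cotpoly m0.
pose r' := Num.min r (pi / 2).
have pi0 := pi_gt0 R.
have r'0 : 0 < r' by rewrite lt_min r0 divr_gt0.
have r'pi : r' <= pi / 2 by rewrite ge_min lexx orbT.
have sr0 : 0 < sin r' by apply: sin_gt0_pi; lra.
have [C C0 qC] := poly_bounded (cotpoly R m) (sin r')^-1.
exists (Num.max `|B| (C + r' ^- m)); first by rewrite le_max normr_ge0.
move=> x /andP[x0 xpi]; rewrite le_max; have [xr|rx] := ltP `|x| r.
  have := rB x; rewrite /ball /= sub0r normrN hornerXn exprVn.
  rewrite -normr_gt0 => /(_ xr x0) H.
  by rewrite (le_trans H (ler_norm _)).
apply/orP; right; apply: le_trans (ler_normB _ _) _; apply: lerD.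
  apply: qC; rewrite /cot normrM normfV -[leRHS]mul1r.
  rewrite ler_pM ?invr_ge0 //; first exact: cos_max.
  have r'x : r' <= `|x| by rewrite ge_min rx.
  have sx : sin r' <= sin `|x|.
    move: r'x; rewrite le_eqVlt => /orP[/eqP <- //|r'x].
    by apply/ltW; rewrite ltr_sin // in_itv /=; lra.
  have sx0 : 0 < sin `|x| by lra.
  have -> : `|sin x| = sin `|x|.
    case: (ger0P x) sx0 => _; rewrite ?sinN => sx0; first by rewrite gtr0_norm.
    by rewrite -normrN gtr0_norm.
  by rewrite lef_pV2.
rewrite normfV normrX lef_pV2 ?posrE ?exprn_gt0 //.
by apply: lerXn2r; rewrite ?nnegrE ?(ltW r'0) // ge_min rx.
Qed.

Lemma big_nat_double (F : nat -> R) n :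
  \sum_(0 <= k < n + n) F k = \sum_(0 <= k < n) (F k + F (k + n)%N).
Proof.
rewrite (big_cat_nat (leq0n n) (leq_addr _ _)) /= big_split /=; congr (_ + _).
by rewrite -{1}[n]add0n big_addn addnK.
Qed.

(** Duplication at (x + k pi) / 2^j yields the points of index k and k + 2^j at level j + 1. *)
Lemma cotpoly_multisection m j x : (0 < m)%N -> 0 < x < pi ->
  2 ^+ (m * j) * (cotpoly R m).[cot x] =
  \sum_(0 <= k < 2 ^ j) (cotpoly R m).[cot ((x + k%:R * pi) / 2 ^+ j)].
Proof.
move=> m0 /andP[x0 xpi]; have pi0 := pi_gt0 R; elim: j => [|j IH].
  by rewrite muln0 !expn0 big_nat1 !expr0 mul1r mul0r addr0 divr1.
rewrite mulnS exprD -mulrA IH mulr_sumr expnS mul2n -addnn.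
rewrite big_nat_double.
apply: eq_big_nat => k /andP[_ kj].
have p0 : 2 ^+ j != 0 :> R by rewrite expf_neq0.
rewrite -cotpoly_cot_dup //.
  congr (_.[cot _] + _.[cot _]); rewrite ?natrD ?natrX exprS; field.
  - exact: p0.
  - exact: p0.
apply: sin_neq0; have y0 : 0 < (x + k%:R * pi) / 2 ^+ j.
  by rewrite divr_gt0 ?exprn_gt0 // ltr_pwDl // mulr_ge0 // ltW.
rewrite gtr0_norm // y0 /= ltr_pdivrMr ?exprn_gt0 //.
have : k.+1%:R <= 2 ^+ j :> R by rewrite -natrX ler_nat.
by rewrite -natr1; nra.
Qed.

(* The sum of (x + k pi)^-m over - K <= k < K. *)
Definition pole_sum (m K : nat) x : R :=
  \sum_(0 <= k < K) ((x + k%:R * pi) ^- m + (x - k.+1%:R * pi) ^- m).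

(* Tannery's argument: after j + 1 duplications all the arguments of the
   cotangent lie in [-pi/2, pi/2], where each term is within B of its pole;
   the total error 2^(j+1) B is divided by 2^((j+1) m), and m > 1. *)
Lemma cotpoly_pole_sum m x : (1 < m)%N -> 0 < x < pi ->
  (fun j => pole_sum m (2 ^ j) x) @ \oo --> (cotpoly R m).[cot x].
Proof.
move=> m1 xpi; have m0 := ltnW m1; have pi0 := pi_gt0 R.
have [B B0 qB] := cotpoly_near_pole m0.
have key j : `|(cotpoly R m).[cot x] - pole_sum m (2 ^ j) x| <= B * 2^-1 ^+ j.
  pose y := 2 ^+ j.+1 : R; have y0 : 0 < y by rewrite exprn_gt0.
  have E : y ^+ m * (cotpoly R m).[cot x] = \sum_(0 <= k < 2 ^ j)
      ((cotpoly R m).[cot ((x + k%:R * pi) / y)] +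
       (cotpoly R m).[cot ((x - k.+1%:R * pi) / y)]).
    rewrite /y -exprM mulnC cotpoly_multisection // expnS mul2n -addnn.
    rewrite big_nat_double !big_split /=; congr (_ + _).
    (* The upper half of the indices, shifted down by one period pi of the cotangent and read
       backwards, gives the points x - (k + 1) pi. *)
    rewrite [RHS]big_nat_rev /= add0n; apply: eq_big_nat => k /andP[_ kj].
    rewrite -[in LHS]cotBpi; congr (_.[cot _]).
    have -> : (2 ^ j - k.+1).+1 = (2 ^ j - k)%N by lia.
    rewrite natrB ?(ltnW kj) // natrD natrX /y exprS; field.
    by rewrite expf_neq0.
  have F : y ^+ m * pole_sum m (2 ^ j) x = \sum_(0 <= k < 2 ^ j)
      (((x + k%:R * pi) / y) ^- m + ((x - k.+1%:R * pi) / y) ^- m).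
    rewrite mulr_sumr; apply: eq_bigr => k _.
    by rewrite mulrDr !expr_div_n !invf_div.
  have := congr1 (fun u => `|u|) (congr2 (fun u v => u - v) E F).
  rewrite -mulrBr -sumrB normrM ger0_norm ?exprn_ge0 ?(ltW y0) // => H.
  have {}H : y ^+ m * `|(cotpoly R m).[cot x] - pole_sum m (2 ^ j) x| <=
      B * y.
    rewrite H; apply: le_trans (ler_norm_sum _ _ _) _.
    apply: (@le_trans _ _ (\sum_(0 <= k < 2 ^ j) (B *+ 2))); last first.
      rewrite sumr_const_nat subn0 -mulrnA -mulr_natr.
      by rewrite -expnS natrX.
    rewrite !big_mkord; apply: ler_sum => k _; rewrite mulr2n.
    rewrite opprD addrACA; apply: le_trans (ler_normD _ _) _.
    have kj : k.+1%:R <= 2 ^+ j :> R by rewrite -natrX ler_nat.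
    have k0 : 0 <= k%:R :> R by [].
    move: kj; rewrite -natr1 => kj; have /andP[x0 xp] := xpi.
    have Ey : y = 2 * 2 ^+ j by rewrite /y exprS.
    apply: lerD; apply: qB.
      have z0 : 0 < x + k%:R * pi by nra.
      rewrite normrM normfV (gtr0_norm z0) (gtr0_norm y0) divr_gt0 //=.
      rewrite ler_pdivrMr // Ey; nra.
    have z0 : x - (k%:R + 1) * pi < 0 by nra.
    rewrite normrM normfV (ltr0_norm z0) (gtr0_norm y0).
    rewrite divr_gt0 ?oppr_gt0 //= ler_pdivrMr // Ey; nra.
  have yy : y ^+ 2 <= y ^+ m by apply: ler_weXn2l => //; rewrite exprn_ege1 ?ler1n.
  set d := `|_| in H *.
  have yd : y * d <= B.
    rewrite -(ler_pM2r y0); apply: le_trans H; rewrite mulrAC -expr2.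
    by rewrite ler_wpM2r ?normr_ge0.
  rewrite exprVn ler_pdivlMr ?exprn_gt0 //; apply: le_trans yd.
  rewrite [leRHS]mulrC ler_wpM2l ?normr_ge0 // /y exprS; have := exprn_gt0 j (ltr0n R 2).
  lra.
apply/cvgrPdist_le => e e0; near=> j; apply: le_trans (key j) _.
apply: le_trans (ler_norm _) _; near: j.
have : geometric B 2^-1 @ \oo --> (0 : R).
  by apply: cvg_geometric; rewrite ger0_norm ?invr_ge0 //; lra.
by move/cvgr0_norm_le; apply.
Unshelve. all: by end_near. Qed.

Lemma csc_sin x n : sin x != 0 -> (1 + cot x ^+ 2) ^+ n = (sin x ^+ (2 * n))^-1.
Proof.
move=> s0; rewrite exprM -exprVn; congr (_ ^+ _).
have := cos2Dsin2 x => E; apply: (mulIf (expf_neq0 2 s0)).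
rewrite mulVf ?expf_neq0 // -[RHS]E /cot; field.
exact: s0.
Qed.

(* The coefficients c_{n,i} are read off the expansion of csc^2n in the basis of
   the cotangent polynomials, because the principal part of the m-th one is x^-m. *)
Lemma c_coef_cotpoly n (c : nat -> R) :
  (1 + 'X ^+ 2) ^+ n = \sum_(1 <= i < n.+1) c i *: cotpoly R (2 * i) ->
  forall i, (1 <= i < n.+1)%N -> c_coef R n i = c i.
Proof.
move=> E i /andP[i1 iln]; pose f x : R := (sin x ^+ (2 * n))^-1.
have fP : ppart f (\sum_(1 <= i < n.+1) c i *: 'X^(2 * i)).
  have : ppart (fun x => \sum_(1 <= i < n.+1) c i * (cotpoly R (2 * i)).[cot x])
      (\sum_(1 <= i < n.+1) c i *: 'X^(2 * i)).
    apply: ppart_sum => j; rewrite mem_index_iota => /andP[j1 _].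
    by apply: ppartZ; apply: ppart_cotpoly; rewrite muln_gt0.
  apply: ppart_ext; near=> x.
  have s0 : sin x != 0 by near: x; exact: near_sin_neq0.
  rewrite /f -csc_sin //.
  have := congr1 (fun p : {poly R} => p.[cot x]) E.
  rewrite !hornerE /= => ->; rewrite horner_sum; apply: eq_bigr => j _.
  by rewrite hornerZ.
have fa : analytic0 (fun x => x ^+ (2 * n) * f x) (1 ^+ (2 * n)).
  apply: analytic0_ext (analytic0X _ (analytic0_x_sin R)); near=> x.
  by rewrite expr_div_n.
rewrite /c_coef (laurent_coef_ppart fa fP) ?muln_gt0 // coef_sum.
rewrite (bigD1_seq i) ?mem_index_iota ?i1 ?iota_uniq //=.
rewrite coefZ coefXn eqxx mulr1 big1 ?addr0 // => j ji.
by rewrite coefZ coefXn eqn_mul2l /= eq_sym (negbTE ji) mulr0.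
Unshelve. all: by end_near. Qed.

Lemma cvg_cotpoly_sum n (a : nat -> R) (e : nat -> nat) x : 0 < x < pi ->
  (forall i, (1 <= i)%N -> (1 < e i)%N) ->
  (fun j => \sum_(1 <= i < n) a i * pole_sum (e i) (2 ^ j) x) @ \oo -->
    (\sum_(1 <= i < n) a i *: cotpoly R (e i)).[cot x].
Proof.
move=> xpi e1; rewrite horner_sum big_nat_cond.
under eq_cvg do rewrite big_nat_cond.
apply: cvg_big; first exact: add_continuous.
move=> i /andP[/andP[i1 _] _]; rewrite hornerZ.
by apply: cvgM; [exact: cvg_cst|apply: cotpoly_pole_sum => //; exact: e1].
Qed.

Lemma csc_pole_sum n x : (0 < n)%N -> 0 < x < pi ->
  (fun j => \sum_(1 <= i < n.+1) c_coef R n i * pole_sum (2 * i) (2 ^ j) x) @ \oo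
    --> (sin x ^+ (2 * n))^-1.
Proof.
move=> n0 xpi; have [c E] := csc_cotpoly R n0.
have s0 : sin x != 0.
  by apply: sin_neq0; case/andP: xpi => x0 xp; rewrite gtr0_norm ?x0.
have -> : (sin x ^+ (2 * n))^-1 = ((1 + 'X ^+ 2) ^+ n).[cot x].
  by rewrite -csc_sin // !hornerE.
have -> : (1 + 'X ^+ 2) ^+ n =
    \sum_(1 <= i < n.+1) c_coef R n i *: cotpoly R (2 * i).
  by rewrite E; apply: eq_big_nat => i /(c_coef_cotpoly E) ->.
by apply: cvg_cotpoly_sum => // i i1; lia.
Qed.

Lemma cotcsc_pole_sum n x : (0 < n)%N -> 0 < x < pi ->
  (fun j => \sum_(1 <= i < n.+1) (n%:R^-1 * (i%:R * c_coef R n i)) *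
      pole_sum (2 * i).+1 (2 ^ j) x) @ \oo
    --> cot x / sin x ^+ (2 * n).
Proof.
move=> n0 xpi; have [c E] := csc_cotpoly R n0.
have s0 : sin x != 0.
  by apply: sin_neq0; case/andP: xpi => x0 xp; rewrite gtr0_norm ?x0.
have -> : cot x / sin x ^+ (2 * n) = ('X * (1 + 'X ^+ 2) ^+ n).[cot x].
  by rewrite -csc_sin // !hornerE.
have -> : 'X * (1 + 'X ^+ 2) ^+ n = \sum_(1 <= i < n.+1)
    (n%:R^-1 * (i%:R * c_coef R n i)) *: cotpoly R (2 * i).+1.
  rewrite (cotcsc_cotpoly n0 E).
  by apply: eq_big_nat => i /(c_coef_cotpoly E) ->.
by apply: cvg_cotpoly_sum => // i i1; lia.
Qed.

End Cotangent.

(** * Sums over residue classes *)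

Section PeriodicSums.
Variables (R : realType) (K : numFieldType) (phi : {rmorphism R -> K}).
Implicit Types (w : nat -> K) (N s : nat).

Lemma sum_nat_blocks (g : nat -> K) N M :
  \sum_(0 <= k < M) \sum_(1 <= m < N.+1) g (m + k * N)%N =
  \sum_(0 <= l < M * N) g l.+1.
Proof.
elim: M => [|M IH]; first by rewrite mul0n !big_geq.
rewrite big_nat_recr //= IH mulSn addnC.
rewrite [RHS](big_cat_nat (leq0n (M * N)) (leq_addr _ _)) /=; congr (_ + _).
rewrite -{2}[(M * N)%N]add0n big_addn addKn big_add1 /=.
by apply: eq_bigr => k _; rewrite addSn.
Qed.

(** At x = m pi / N the poles are pi / N times m + k N on one side and -(N - m + k N) on the other;
    the sign of the latter gives (-1)^s. *)
Lemma pole_sum_pi N s M m : (0 < m < N)%N ->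
  phi (pole_sum s M (m%:R * pi / N%:R)) = phi (N%:R ^+ s / pi ^+ s) *
  (\sum_(0 <= k < M) (m + k * N)%:R ^- s +
   (-1) ^+ s * \sum_(0 <= k < M) (N - m + k * N)%:R ^- s).
Proof.
move=> /andP[m0 mN]; have pi0 : pi != 0 :> R by rewrite gt_eqF // pi_gt0.
have N0 : N%:R != 0 :> R by rewrite pnatr_eq0; lia.
have inv_phi (k : nat) : k%:R ^- s = phi (k%:R ^- s) :> K.
  by rewrite fmorphV rmorphXn /= rmorph_nat.
rewrite mulr_sumr -big_split /= (eq_bigr (fun k => phi
    ((m + k * N)%:R ^- s + (-1) ^+ s * (N - m + k * N)%:R ^- s))); last first.
  by move=> k _; rewrite !inv_phi (rmorphD phi) (rmorphM phi) rmorphXn rmorphN1.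
rewrite -rmorph_sum -rmorphM; congr (phi _).
rewrite mulr_sumr; apply: eq_bigr => k _.
have -> : m%:R * pi / N%:R + k%:R * pi = (m + k * N)%:R * (pi / N%:R) :> R.
  by rewrite natrD natrM; field.
have -> : m%:R * pi / N%:R - k.+1%:R * pi = - 1 * (N - m + k * N)%:R * (pi / N%:R) :> R.
  by rewrite natrD natrB ?(ltnW mN) // natrM; field.
have -> : N%:R ^+ s / pi ^+ s = (pi / N%:R) ^- s :> R.
  by rewrite -expr_div_n -exprVn invf_div.
move: (pi / N%:R) => c; rewrite !exprMn !invfM invr_sign; ring.
Qed.

(** The sign (-1)^s of the negative poles is absorbed by the parity of w. The reflection of m to N -
    m then identifies their contribution with that of the positive ones, whence the factor 2. *)
Lemma sum_periodic_pole_sum w N s M : (0 < N)%N ->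
  (forall m, w (m + N)%N = w m) -> w 0%N = 0 ->
  (forall m, (0 < m < N)%N -> w (N - m)%N = (-1) ^+ s * w m) ->
  \sum_(1 <= m < N) w m * phi (pole_sum s M (m%:R * pi / N%:R)) =
  2 * phi (N%:R ^+ s / pi ^+ s) *
    \sum_(0 <= k < M * N) w k.+1 / k.+1%:R ^+ s.
Proof.
move=> N0 wN w0 wV.
pose T m := \sum_(0 <= k < M) (m + k * N)%:R ^- s : K.
have wkN k m : w (m + k * N)%N = w m.
  by elim: k => [|k IH]; rewrite ?addn0 // mulSn addnCA addnC wN.
have -> : \sum_(0 <= k < M * N) w k.+1 / k.+1%:R ^+ s = \sum_(1 <= m < N) w m * T m.
  rewrite -(sum_nat_blocks (fun l => w l / l%:R ^+ s)) exchange_big_nat /=.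
  (* A block of N consecutive integers also contains the residue m = N, where w vanishes. *)
  rewrite big_nat_recr //= [X in _ + X]big1 ?addr0 => [|k _]; last first.
    by rewrite wkN -[N]add0n wN w0 mul0r.
  apply: eq_bigr => m _; rewrite mulr_sumr; apply: eq_bigr => k _.
  by rewrite wkN.
transitivity (phi (N%:R ^+ s / pi ^+ s) * (\sum_(1 <= m < N) w m * T m +
    \sum_(1 <= m < N) w (N - m)%N * T (N - m)%N)).
  rewrite -big_split mulr_sumr; apply: eq_big_nat => m mN.
  by rewrite pole_sum_pi // wV // -/(T m) -/(T (N - m)%N) /=; ring.
rewrite [X in _ + X]big_nat_rev /=.
rewrite [X in _ + X](_ : _ = \sum_(1 <= m < N) w m * T m).
  by rewrite [RHS]mulrAC mulrDr mulrC -[RHS]mulrA mulr_natl mulr2n.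
apply: eq_big_nat => m /andP[m1 mN].
by rewrite (_ : N - (1 + N - m.+1) = m)%N //; lia.
Qed.

(** Both sides are limits of the same finite sums [A j]. The morphism [phi] lets one statement serve
    the real zeta sum (identity) and the complex character sums (embedding of R). *)
Lemma cvg_pole_sums N n w (a : nat -> R) (e : nat -> nat) (f : R -> R)
    (L : nat -> K) : (0 < N)%N ->
  (forall u (l : R), u @ \oo --> l -> (fun j : nat => phi (u j)) @ \oo --> phi l) ->
  (forall x, 0 < x < pi ->
    (fun j => \sum_(1 <= i < n) a i * pole_sum (e i) (2 ^ j) x) @ \oo --> f x) ->
  (forall m, w (m + N)%N = w m) -> w 0%N = 0 ->
  (forall i m, (1 <= i < n)%N -> (0 < m < N)%N ->
    w (N - m)%N = (-1) ^+ e i * w m) ->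
  (forall i, (1 <= i < n)%N ->
    (fun j => \sum_(0 <= k < 2 ^ j * N) w k.+1 / k.+1%:R ^+ e i) @ \oo --> L i) ->
  \sum_(1 <= m < N) w m * phi (f (m%:R * pi / N%:R)) =
  2 * \sum_(1 <= i < n) phi (a i * (N%:R ^+ e i / pi ^+ e i)) * L i.
Proof.
move=> N0 phi_cvg fE wN w0 wV wL.
pose A j := \sum_(1 <= m < N) w m *
  phi (\sum_(1 <= i < n) a i * pole_sum (e i) (2 ^ j) (m%:R * pi / N%:R)).
apply: (@norm_cvg_unique _ K^o (A @ \oo)) => /=.
  rewrite big_nat_cond /A; under eq_cvg do rewrite big_nat_cond.
  apply: cvg_big; first exact: add_continuous.
  move=> m /andP[/andP[m0 mN] _]; apply: cvgM; first exact: cvg_cst.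
  apply: phi_cvg; apply: fE; rewrite divr_gt0 ?mulr_gt0 ?pi_gt0 ?ltr0n //=.
  by rewrite ltr_pdivrMr ?ltr0n // mulrC ltr_pM2l ?pi_gt0 // ltr_nat.
have AE j : A j = 2 * \sum_(1 <= i < n) phi (a i * (N%:R ^+ e i / pi ^+ e i)) *
    \sum_(0 <= k < 2 ^ j * N) w k.+1 / k.+1%:R ^+ e i.
  rewrite /A; under eq_bigr do rewrite rmorph_sum mulr_sumr.
  rewrite exchange_big_nat /= mulr_sumr; apply: eq_big_nat => i i1.
  under eq_bigr do rewrite rmorphM mulrCA.
  rewrite -mulr_sumr (sum_periodic_pole_sum _ N0) //; last by move=> m; apply: wV.
  by rewrite rmorphM; ring.
under eq_cvg do rewrite AE.
apply: cvgM; first exact: cvg_cst.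
rewrite big_nat_cond; under eq_cvg do rewrite big_nat_cond.
apply: cvg_big; first exact: add_continuous.
move=> i /andP[i1 _]; apply: cvgM; first exact: cvg_cst.
exact: wL.
Qed.

End PeriodicSums.

(** * L-series *)

Section LSeries.
Variable R : realType.

Lemma cvg_zeta_series s : (1 < s)%N ->
  cvgn (series (fun k : nat => (k.+1%:R ^+ s)^-1 : R)).
Proof.
move=> s1; apply: (@series_le_cvg _ _ (fun k : nat => (k.+1%:R ^+ 2)^-1)).
- by move=> k; rewrite invr_ge0 exprn_ge0.
- by move=> k; rewrite invr_ge0 exprn_ge0.
- move=> k; rewrite lef_pV2 ?posrE ?exprn_gt0 ?ltr0n //.
  by apply: ler_weXn2l; rewrite // ler1n.
apply: nondecreasing_is_cvgn.
  by apply: nondecreasing_series => k _ _; rewrite invr_ge0 exprn_ge0.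
(* The bound 2 - 2 / (n + 1) telescopes: its increment dominates 1 / (n + 1)^2. *)
exists 2 => _ [n _ <-]; apply: (@le_trans _ _ (2 - 2 / n.+1%:R)); last first.
  by rewrite gerBl divr_ge0.
rewrite /series /=; elim: n => [|n IH]; first by rewrite big_geq // divr1 subrr.
rewrite big_nat_recr //=; apply: le_trans (lerD IH (lexx _)) _.
have x1 : 1 <= n.+1%:R :> R by rewrite ler1n.
rewrite -[n.+2%:R]natr1; move: (n.+1%:R) x1 => x x1.
have x0 : 0 < x by lra.
have x10 : 0 < x + 1 by lra.
rewrite -subr_ge0 (_ : _ - _ = (x - 1) / (x ^+ 2 * (x + 1))).
  by rewrite divr_ge0 ?mulr_ge0 ?exprn_ge0; lra.
by field; rewrite !gt_eqF.
Qed.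

Lemma cvg_pow2_mul N : (0 < N)%N -> (fun j => 2 ^ j * N)%N @ \oo --> \oo.
Proof.
move=> N0; apply/cvgnyPge => A; near=> j.
have Aj : (A <= j)%N by near: j; exact: nbhs_infty_ge.
by apply: leq_trans Aj _; apply: leq_trans (ltnW (ltn_expl j _)) (leq_pmulr _ N0).
Unshelve. all: by end_near. Qed.

(** The weight keeps the non-multiples of N. Each block of N integers loses exactly its last
    element, and the removed terms form a zeta sum scaled by N^-s. *)
Lemma sum_coprime_zeta N s M : (0 < N)%N ->
  \sum_(0 <= k < M * N) (~~ (N %| k.+1)%N)%:R / k.+1%:R ^+ s =
  \sum_(0 <= k < M * N) (k.+1%:R ^+ s)^-1 -
  (N%:R ^+ s)^-1 * \sum_(0 <= k < M) (k.+1%:R ^+ s)^-1 :> R.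
Proof.
move=> N0; rewrite -(sum_nat_blocks (fun l => (~~ (N %| l)%N)%:R / l%:R ^+ s : R)).
rewrite -(sum_nat_blocks (fun l => (l%:R ^+ s)^-1 : R)) mulr_sumr -sumrB.
apply: eq_bigr => k _; rewrite !big_nat_recr //=.
rewrite -mulSn dvdn_mull // mul0r addr0 natrM exprMn invfM mulrC addrK.
apply: eq_big_nat => m /andP[m0 mN].
by rewrite dvdn_addl ?dvdn_mull // gtnNdvd // mul1r.
Qed.

Lemma cvg_real_complex (u : nat -> R) (l : R) :
  u @ \oo --> l -> (fun j => (u j)%:C : R[i]^o) @ \oo --> (l%:C : R[i]^o).
Proof.
move=> ul; apply/cvgrPdist_lt => e e0.
have eE := RRe_real (gtr0_real e0).
have Re0 : 0 < complex.Re e by rewrite -ltcR eE.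
have /cvgrPdist_lt/(_ _ Re0) := ul; apply: filterS => j.
by rewrite -rmorphB normc_def /= expr0n addr0 sqrtr_sqr -[e]eE ltcR.
Qed.

Lemma periodic_bounded (r : nat -> R) N : (forall m, r (m + N)%N = r m) ->
  (0 < N)%N -> exists2 C, 0 <= C & forall k, `|r k| <= C.
Proof.
move=> rN N0; exists (\sum_(m < N) `|r m|); first exact: sumr_ge0.
move=> k; have -> : r k = r (k %% N)%N.
  rewrite {1}(divn_eq k N) addnC; elim: (k %/ N)%N => [|d IH]; first by rewrite addn0.
  by rewrite mulSn addnCA addnC rN IH.
rewrite (bigD1 (Ordinal (ltn_pmod k N0))) //= lerDl.
by apply: sumr_ge0.
Qed.

Lemma cvg_bounded_series (r : nat -> R) C s : (1 < s)%N ->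
  0 <= C -> (forall k, `|r k| <= C) ->
  cvgn (series (fun k => r k.+1 * (k.+1%:R ^+ s)^-1)).
Proof.
move=> s1 C0 rC; apply: normed_cvg => /=.
apply: (@series_le_cvg _ _ (C *: (fun k : nat => (k.+1%:R ^+ s)^-1))).
- by move=> k; exact: normr_ge0.
- by move=> k; rewrite fctE mulr_ge0 // invr_ge0 exprn_ge0.
- move=> k /=; rewrite normrM fctE [`|_^-1|]ger0_norm ?invr_ge0 ?exprn_ge0 //.
  by rewrite /GRing.scale /= ler_wpM2r // invr_ge0 exprn_ge0.
by apply: is_cvg_seriesZ; exact: cvg_zeta_series.
Qed.

Lemma cvg_periodic_complex_series (w : nat -> R[i]) N s :
  (forall m, w (m + N)%N = w m) -> (0 < N)%N -> (1 < s)%N ->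
  cvgn (series (fun k : nat => w k.+1 / k.+1%:R ^+ s : R[i]^o)).
Proof.
move=> wN N0 s1.
have [C1 C10 wC1] := periodic_bounded (fun m => congr1 (@complex.Re R) (wN m)) N0.
have [C2 C20 wC2] := periodic_bounded (fun m => congr1 (@complex.Im R) (wN m)) N0.
have /cvg_ex[a aE] := cvg_bounded_series s1 C10 wC1.
have /cvg_ex[b bE] := cvg_bounded_series s1 C20 wC2.
apply/cvg_ex; exists (a%:C + 'i * b%:C : R[i]^o).
have := cvgD (cvg_real_complex aE)
  (cvgM (cvg_cst ('i : R[i]^o)) (cvg_real_complex bE)).
set u := (X in X y @[y --> _] --> _); set v := series _.
have -> : v = u; last by apply.
apply/funext => n; rewrite /u /v /series /= !rmorph_sum mulr_sumr -big_split.
apply: eq_bigr => k _ /=.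
rewrite [in LHS](complexE (w k.+1)) !rmorphM /= fmorphV rmorphXn rmorph_nat mulrDl.
by rewrite mulrA.
Qed.

(** The series converges by periodicity of the character, so its value can be computed along the
    truncations 2^j N that repeated duplication produces. *)
Lemma dirichlet_L_pow2 N (chi : dirichlet_char R N) s : (0 < N)%N -> (1 < s)%N ->
  (forall m : nat, dchar_ext chi (m + N)%N%:Z = dchar_ext chi m%:Z) ->
  (fun j => \sum_(0 <= k < 2 ^ j * N) dchar_ext chi k.+1%:Z / k.+1%:R ^+ s : R[i]^o)
    @ \oo --> (dirichlet_L chi s : R[i]^o).
Proof.
move=> N0 s1 chiN.
have H := @cvg_periodic_complex_series (fun k => dchar_ext chi k%:Z) _ _ chiN N0 s1.
exact: (cvg_comp _ _ (cvg_pow2_mul N0) H).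
Qed.

End LSeries.

(** * Periodicity and parity of Dirichlet characters *)

Section DirichletCharacter.
Variables (R : realType) (N : nat) (chi : dirichlet_char R N).
Hypothesis N1 : (1 < N)%N.

Lemma dchar_ext_periodic (m : nat) :
  dchar_ext chi (m + N)%N%:Z = dchar_ext chi m%:Z.
Proof.
rewrite /dchar_ext (_ : (m + N)%N%:Z%:~R = m%:Z%:~R :> 'Z_N) //.
by rewrite -!pmulrn natrD (pchar_Zp N1) addr0.
Qed.

Lemma dchar_ext0 : dchar_ext chi 0 = 0.
Proof. by rewrite /dchar_ext insubF // unitr0. Qed.

Lemma dchar_extN (m : nat) : (m <= N)%N ->
  dchar_ext chi (N - m)%N%:Z = dchar_ext chi (-1) * dchar_ext chi m%:Z.
Proof.
move=> mN; rewrite /dchar_ext.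
have -> : (N - m)%N%:Z%:~R = - (m%:Z%:~R) :> 'Z_N.
  by rewrite -!pmulrn natrB // (pchar_Zp N1) sub0r.
case: (insubP _ (m%:Z%:~R : 'Z_N)) => [u mu um|mu]; last first.
  by rewrite mulr0 insubF // unitrN (negbTE mu).
have m1u : ((-1)%:~R : 'Z_N) \is a GRing.unit by rewrite rmorphN1 unitrN1.
have vu : - (m%:Z%:~R : 'Z_N) \is a GRing.unit by rewrite unitrN.
case: insubP => [v _ vE|]; last by rewrite vu.
case: insubP => [e _ eE|]; last by rewrite m1u.
rewrite -dcharM; congr (chi _); apply: val_inj.
by rewrite /= vE eE um rmorphN1 mulN1r.
Qed.

End DirichletCharacter.

(** * Finite sums at m pi / N as values of L and zeta *)

Section Main.
Variables (R : realType) (N n : nat).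
Hypotheses (N1 : (1 < N)%N) (n0 : (0 < n)%N).
Let N0 : (0 < N)%N := ltnW N1.

Lemma L_ZN_even (chi : dirichlet_char R N) : even_dchar chi ->
  L_ZN n chi = 2 * \sum_(1 <= i < n.+1)
    (c_coef R n i * (N%:R ^+ (2 * i) / pi ^+ (2 * i)))%:C
      * dirichlet_L chi (2 * i).
Proof.
move=> chi1.
have := @cvg_pole_sums R R[i] (real_complex R) N n.+1 (fun k => dchar_ext chi k%:Z)
  (c_coef R n) (fun i => 2 * i)%N (fun x => (sin x ^+ (2 * n))^-1)
  (fun i => dirichlet_L chi (2 * i)) N0 (@cvg_real_complex R) (fun x xpi => csc_pole_sum n0 xpi)
  (dchar_ext_periodic chi N1) (dchar_ext0 chi).
rewrite /L_ZN => <- //.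
- by apply: eq_bigr => m _; rewrite fmorphV.
- move=> i m _ /andP[_ /ltnW mN]; rewrite dchar_extN //.
  by rewrite chi1 exprM sqrrN !expr1n.
- move=> i /andP[i1 _]; apply: dirichlet_L_pow2 => //; first by lia.
  exact: dchar_ext_periodic.
Qed.

Lemma zeta_ZN_sum : zeta_ZN R N n = 2 * \sum_(1 <= i < n.+1)
  c_coef R n i * ((N%:R ^+ (2 * i) - 1) / pi ^+ (2 * i)) * riemann_zeta R (2 * i).
Proof.
have NR0 : N%:R != 0 :> R by rewrite pnatr_eq0; lia.
(* The weight is the indicator of the non-multiples of N: unlike the principal character it is 1 at
   every m from 1 to N - 1. The factor 1 - N^(-2i) it produces combines with N^(2i) to N^(2i) -
   1. *)
have := @cvg_pole_sums R R idfun N n.+1 (fun k => (~~ (N %| k)%N)%:R)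
  (c_coef R n) (fun i => 2 * i)%N (fun x => (sin x ^+ (2 * n))^-1)
  (fun i => (1 - (N%:R ^+ (2 * i))^-1) * riemann_zeta R (2 * i)) N0
  (fun u l ul => ul) (fun x xpi => csc_pole_sum n0 xpi).
rewrite /zeta_ZN => H; rewrite [LHS](_ : _ =  \sum_(1 <= m < N)
  (~~ (N %| m)%N)%:R * (sin (m%:R * pi / N%:R) ^+ (2 * n))^-1); last first.
  by apply: eq_big_nat => m /andP[m0 mN]; rewrite gtnNdvd // mul1r.
rewrite {}H.
- congr (_ * _); apply: eq_bigr => i _ /=.
  have pi0 : pi != 0 :> R by rewrite gt_eqF // pi_gt0.
  by field; rewrite !expf_neq0.
- by move=> m; rewrite dvdn_addl.
- by rewrite dvdn0.
- move=> i m _ /andP[m0 mN].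
  by rewrite exprM sqrrN !expr1n mul1r !gtnNdvd //; lia.
- move=> i /andP[i1 _]; under eq_cvg do rewrite sum_coprime_zeta //.
  have zs := @cvg_zeta_series R (2 * i) ltac:(lia).
  rewrite mulrBl mul1r; apply: cvgB.
    exact: (cvg_comp _ _ (cvg_pow2_mul N0) zs).
  apply: cvgM; first exact: cvg_cst.
  have := cvg_pow2_mul (ltn0Sn 0); under eq_cvg do rewrite muln1.
  move=> p2; exact: (cvg_comp _ _ p2 zs).
Qed.

Lemma Ltilde_ZN_odd (chi : dirichlet_char R N) : odd_dchar chi ->
  Ltilde_ZN n chi = 2 / n%:R * \sum_(1 <= i < n.+1)
    (i%:R * c_coef R n i * (N%:R ^+ (2 * i).+1 / pi ^+ (2 * i).+1))%:C
      * dirichlet_L chi (2 * i).+1.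
Proof.
move=> chi1.
have := @cvg_pole_sums R R[i] (real_complex R) N n.+1 (fun k => dchar_ext chi k%:Z)
  (fun i => n%:R^-1 * (i%:R * c_coef R n i)) (fun i => (2 * i).+1)%N
  (fun x => cot x / sin x ^+ (2 * n))
  (fun i => dirichlet_L chi (2 * i).+1) N0 (@cvg_real_complex R)
  (fun x xpi => cotcsc_pole_sum n0 xpi)
  (dchar_ext_periodic chi N1) (dchar_ext0 chi).
rewrite /Ltilde_ZN => H.
transitivity (\sum_(1 <= m < N) dchar_ext chi m%:Z *
  (cot (m%:R * pi / N%:R) / sin (m%:R * pi / N%:R) ^+ (2 * n))%:C).
  by apply: eq_bigr => m _; rewrite -mulrA -fmorphV -rmorphM.
rewrite H.
- rewrite -[RHS]mulrA; congr (_ * _); rewrite mulr_sumr; apply: eq_bigr => i _.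
  rewrite [RHS]mulrA; congr (_ * _).
  have -> : n%:R^-1 = (n%:R^-1)%:C :> R[i] by rewrite fmorphV rmorph_nat.
  by rewrite -(mulrA n%:R^-1) [LHS]rmorphM.
- move=> i m _ /andP[_ /ltnW mN]; rewrite dchar_extN //.
  (* The exponent 2i + 1 is odd, so (-1)^(2i+1) matches the value -1 of the character at -1. *)
  by rewrite chi1 exprS exprM sqrrN !expr1n mulr1.
- move=> i /andP[i1 _]; apply: dirichlet_L_pow2 => //; first by lia.
  exact: dchar_ext_periodic.
Qed.

End Main.

Local Close Scope classical_set_scope.

Theorem proposition4p6 (R : realType) (N n : nat) (hN : (2 <= N)%N)
    (hn : (1 <= n)%N) :
  ((forall chi : dirichlet_char R N, even_dchar chi ->
      L_ZN n chi =
        2 * \sum_(1 <= i < n.+1)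
          (c_coef R n i * (N%:R ^+ (2 * i) / pi ^+ (2 * i)))%:C
            * dirichlet_L chi (2 * i)) /\
   zeta_ZN R N n =
     2 * \sum_(1 <= i < n.+1)
       c_coef R n i * ((N%:R ^+ (2 * i) - 1) / pi ^+ (2 * i))
         * riemann_zeta R (2 * i)) /\
  (forall chi : dirichlet_char R N, odd_dchar chi ->
     Ltilde_ZN n chi =
       2 / n%:R * \sum_(1 <= i < n.+1)
         (i%:R * c_coef R n i
            * (N%:R ^+ (2 * i).+1 / pi ^+ (2 * i).+1))%:C
           * dirichlet_L chi (2 * i).+1).
Proof.
split; [split|].
- by move=> chi; exact: L_ZN_even.
- exact: zeta_ZN_sum.
- by move=> chi; exact: Ltilde_ZN_odd.
Qed.
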